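(* Any (possibly randomized) non-adaptive algorithm that, given as input $\varepsilon\in(0,1)$ and access to a $\mathrm{maxsample}$ oracle for any MNL $M$ supported on $[n]$, outputs an MNL $\hat M$ satisfying $\Pr[d_\infty(M,\hat M)\le\varepsilon]\ge\frac{9}{10}$, must make $\Omega\left(\frac{n^2}{\varepsilon^2}\log n\right)$ queries in the worst case.
   Context: A multinomial logit model (MNL) $M$ supported on $[n]=\{1,\dots,n\}$ is given by positive weights $w_1,\dots,w_n>0$; for every non-empty $S\subseteq[n]$ it induces the distribution $M_S$ on $S$ with $M_S(i)=w_i/\sum_{j\in S}w_j$. A $\mathrm{maxsample}$ oracle for $M$, given a non-empty slate $S\subseteq[n]$ (of any size), returns an item of $S$ drawn from $M_S$, independently across queries; each call counts as one query. A non-adaptive algorithm fixes all its queries (possibly at random) before seeing any answer. $d_\infty(M,M')=\max_{\emptyset\neq S\subseteq[n]}\|M_S-M'_S\|_\infty$.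
   Formalization: The constant in Ω and the threshold on n may depend on a fixed bound ε₁<1, and the bound is proved for all 0<ε≤ε₁; with one constant for all ε in (0,1) it fails, since for ε≥1−1/n the uniform MNL is correct with no queries. *)

(* Defs.v *)
From HB Require Import structures.
From mathcomp Require Import all_boot all_order all_algebra.
From mathcomp Require Import all_classical all_reals all_analysis.

Set Implicit Arguments.
Unset Strict Implicit.
Unset Printing Implicit Defensive.

Import Order.TTheory GRing.Theory Num.Theory.
Import numFieldNormedType.Exports.

Local Open Scope classical_set_scope.
Local Open Scope ring_scope.

(* The item universe [n] = {1, ..., n} is represented by 'I_n. *)
Record mnl (R : realType) (n : nat) := Mnl {
  mnl_weight :> 'I_n -> R;
  mnl_weight_gt0 : forall i, 0 < mnl_weight i
}.

Definition slate (n : nat) := {S : {set 'I_n} | S != finset.set0}.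

(* M_S(i), extended by 0 to the items outside S. *)
Definition mnl_prob (R : realType) (n : nat) (M : mnl R n) (S : slate n)
    (i : 'I_n) : R :=
  if i \in val S then M i / \sum_(j in val S) M j else 0.

(* The iterated maxima start from 0, which is harmless because every term is
   nonnegative. *)
Definition dinfty (R : realType) (n : nat) (M M' : mnl R n) : R :=
  \big[Num.max/0]_(S : slate n)
    \big[Num.max/0]_(i : 'I_n) `|mnl_prob M S i - mnl_prob M' S i|.

(* All the internal randomness is carried by a seed w in T.  Non-adaptivity is
   the fact that [queries] depends on the seed only; [output w a] is the model
   returned when the i-th query of [queries w] is answered by the i-th item of
   [a].  Since [seq (slate n)] is countable, [queries_measurable] says that
   [queries] is measurable for the discrete sigma-algebra. *)
Record nonadaptive_algorithm (R : realType) (n : nat) (d : measure_display)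
    (T : measurableType d) := NonadaptiveAlgorithm {
  seed_law : probability T R;
  queries : T -> seq (slate n);
  output : T -> seq 'I_n -> mnl R n;
  queries_measurable :
    forall s : seq (slate n), measurable (queries @^-1` [set s]);
  output_measurable : forall (a : seq 'I_n) (i : 'I_n),
    measurable_fun [set: T] (fun w => output w a i : R)
}.

(* Probability that independent maxsample calls on the slates s return a. *)
Definition answers_prob (R : realType) (n : nat) (M : mnl R n)
    (s : seq (slate n)) (a : (size s).-tuple 'I_n) : R :=
  \prod_(p <- zip s a) mnl_prob M p.1 p.2.

Definition success_prob_given_seed (R : realType) (n : nat)
    (d : measure_display) (T : measurableType d)
    (A : nonadaptive_algorithm R n T) (eps : R) (M : mnl R n) (w : T) : R :=
  \sum_(a : (size (queries A w)).-tuple 'I_n | dinfty M (output A w a) <= eps)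
    answers_prob M a.

(* Pr[dinfty M Mhat <= eps], over the seed and the oracle's answers. *)
Definition success_prob (R : realType) (n : nat) (d : measure_display)
    (T : measurableType d) (A : nonadaptive_algorithm R n T) (eps : R)
    (M : mnl R n) : \bar R :=
  (\int[seed_law A]_w (success_prob_given_seed A eps M w)%:E)%E.

Definition learns_mnl (R : realType) (n : nat) (d : measure_display)
    (T : measurableType d) (A : nonadaptive_algorithm R n T) (eps : R) : Prop :=
  forall M : mnl R n, ((9 / 10 : R)%:E <= success_prob A eps M)%E.

(* The slates queried do not depend on M, so the worst case is over the seed;
   seeds of probability 0 are disregarded. *)
Definition makes_at_most (R : realType) (n : nat) (d : measure_display)
    (T : measurableType d) (A : nonadaptive_algorithm R n T) (q : nat) : Prop :=
  {ae seed_law A, forall w, (size (queries A w) <= q)%N}.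

(* Main.v *)
(* Hard instances: half of the items, chosen by independent coins inside fixed
   couples, are put by a random permutation into tiers of K items, the weights
   of successive tiers being separated by a huge factor B, and all the other
   items sit above these tiers. In each tier one uniformly chosen item has its
   weight multiplied by 1 + th, where th is proportional to eps. A correct
   answer gives more than 1/K to the tilted item of each tier, hence excludes at
   least one candidate per tier; this works for all eps up to eps1 < 1 once K is
   large compared with 1 / (1 - eps1).

   As B grows, a slate only reveals the law of its topmost tier, and it says
   something about the tilt of a low tier only if it avoids all the upper items
   and hits that tier twice. For a slate fixed in advance meeting k couples this
   has probability O(k^2 / 2^k / n) = O(1/n), so that a low tier receives on
   average O(q / n^2) informative answers. Each of them multiplies the second
   moment of the likelihood ratio with respect to the uniform law by at most
   1 + th^2, and the tiers are independent given the tier structure, so unless q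
   is of order n^2 ln n / eps^2 the success probability is at most a product of
   about n factors 1 - O(n^(-1/2)). *)

Require Import Defs.
From mathcomp Require Import all_boot all_order all_algebra.
From mathcomp Require Import all_classical all_reals all_analysis.
From mathcomp Require Import fingroup perm measurable_realfun ring lra zify.

Set Implicit Arguments.
Unset Strict Implicit.
Unset Printing Implicit Defensive.

Import Order.TTheory GRing.Theory Num.Theory.
Import HBNNSimple.

Local Open Scope ring_scope.

(** * Product laws *)

Lemma prod_by_group (R : comPzRingType) (I G : finType) (grp : I -> G)
    (F : I -> G -> R) :
  \prod_g \prod_(k | grp k == g) F k g = \prod_k F k (grp k).
Proof.
rewrite [RHS](partition_big grp predT)//=.
by apply: eq_bigr => g _; apply: eq_bigr => k /eqP ->.
Qed.

(* Functions of disjoint groups of coordinates are uncorrelated; here each of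
   them is a combination of products over its coordinates. *)
Lemma sum_prod_by_group (R : comPzRingType) (I G J Y : finType)
    (grp : I -> G) (c : G -> J -> R) (f : I -> J -> Y -> R) :
  \sum_(a : {ffun I -> Y})
     \prod_g \sum_j c g j * \prod_(k | grp k == g) f k j (a k) =
  \prod_g \sum_j c g j * \prod_(k | grp k == g) \sum_y f k j y.
Proof.
transitivity (\sum_(a : {ffun I -> Y}) \sum_(h : {ffun G -> J})
    \prod_g (c g (h g) * \prod_(k | grp k == g) f k (h g) (a k))).
  by apply: eq_bigr => a _; rewrite bigA_distr_bigA.
rewrite exchange_big [RHS]bigA_distr_bigA /=; apply: eq_bigr => h _.
rewrite big_split (prod_by_group grp (fun k g => \sum_y f k (h g) y)) /=.
rewrite bigA_distr_bigA big_distrr /=; apply: eq_bigr => a _.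
by rewrite big_split (prod_by_group grp (fun k g => f k (h g) (a k))).
Qed.

(* AM-GM: [l + s ^ 2 r ^ 2 / l >= 2 s r]. *)
Lemma sum_but_one_le (R : realFieldType) (X : finType) (l : X -> R) (r s : R)
    (z : X) :
  (forall x, 0 <= l x) -> (forall x, l x = 0 -> r = 0) ->
  \sum_(x | x != z) l x <=
    \sum_x l x - 2 * s * r + s ^+ 2 * \sum_x r ^+ 2 / l x.
Proof.
move=> l0 lr; rewrite [\sum_x l x](bigD1 z)//= [\sum_x r ^+ 2 / l x](bigD1 z)//=.
have : 0 <= \sum_(x | x != z) r ^+ 2 / l x.
  by apply: sumr_ge0 => x _; rewrite divr_ge0// sqr_ge0.
have s2 : 0 <= s ^+ 2 by exact: sqr_ge0.
move=> /(mulr_ge0 s2).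
have : 2 * s * r <= l z + s ^+ 2 * (r ^+ 2 / l z).
  have [lz|lz] := eqVneq (l z) 0; first by rewrite (lr _ lz) lz; lra.
  have lz0 : 0 < l z by rewrite lt_neqAle eq_sym lz l0.
  rewrite -subr_ge0.
  have -> : l z + s ^+ 2 * (r ^+ 2 / l z) - 2 * s * r = (l z - s * r) ^+ 2 / l z.
    by field.
  by rewrite divr_ge0// sqr_ge0.
rewrite mulrDr; lra.
Qed.

Lemma big_sum3 (R : comPzRingType) (X : finType) (F : X + option X -> R) :
  \sum_j F j = \sum_x F (inl x) + F (inr None) + \sum_x F (inr (Some x)).
Proof.
rewrite big_sumType /= -addrA; congr (_ + _).
rewrite (bigD1 None)//=; congr (_ + _).
rewrite (reindex_omap Some id) => [|[x|]]//.
by apply: eq_bigl => x; rewrite eqxx.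
Qed.

(** The excluded candidate [sel a g] may depend on all of [a], so the groups do not separate
    directly. In each group [sum_but_one_le], with [r] the reference likelihood, gives a bound free
    of [sel], whose sum over [a] factorises. *)
Lemma direct_product_bound (R : realFieldType) (I G X Y : finType)
    (grp : I -> G) (A : pred G) (q : I -> Y -> R) (p : I -> X -> Y -> R)
    (kap : G -> R) (sel : {ffun I -> Y} -> G -> X) :
  (1 < #|X|)%N ->
  (forall k x y, 0 <= p k x y) ->
  (forall k x y, p k x y = 0 -> q k y = 0) ->
  (forall k, \sum_y q k y = 1) -> (forall k x, \sum_y p k x y = 1) ->
  (forall g, 1 <= kap g) ->
  (forall g x, A g ->
     \prod_(k | grp k == g) \sum_y q k y ^+ 2 / p k x y <= kap g) ->
  \sum_(x : {ffun G -> X})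
     \sum_(a : {ffun I -> Y} | [forall g, A g ==> (x g != sel a g)])
        \prod_k p k (x (grp k)) (a k)
  <= #|X|%:R ^+ #|G| * \prod_(g | A g) (1 - (#|X|%:R ^+ 2 * kap g)^-1).
Proof.
move=> X1 p0 pq q1 p1 k1 hk.
have n1 : 2 <= #|X|%:R :> R by rewrite ler_nat.
have n0 : 0 < #|X|%:R :> R by lra.
have k0 g : 0 < kap g by exact: lt_le_trans (k1 g).
(* This value maximises [2 * s - s ^+ 2 * (#|X| * kap)]. *)
pose s g : R := (#|X|%:R * kap g)^-1.
(* The index [j] labels the terms of [sum_but_one_le]: likelihoods of candidates ([inl]), the
   reference likelihood ([inr None]) and the chi-square terms ([inr (Some _)]). *)
pose c g (j : X + option X) : R :=
  match j with
  | inl _ => 1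
  | inr None => if A g then - (2 * s g) else 0
  | inr (Some _) => if A g then s g ^+ 2 else 0
  end.
pose f k (j : X + option X) y : R :=
  match j with
  | inl x => p k x y
  | inr None => q k y
  | inr (Some x) => q k y ^+ 2 / p k x y
  end.
pose L g x (a : {ffun I -> Y}) := \prod_(k | grp k == g) p k x (a k).
have L0 g x a : 0 <= L g x a by apply: prodr_ge0 => k _; exact: p0.
pose H (a : {ffun I -> Y}) g :=
  \sum_j c g j * \prod_(k | grp k == g) f k j (a k).
have HE a g : H a g = \sum_x L g x a +
    (if A g then - (2 * s g) else 0) * \prod_(k | grp k == g) q k (a k) +
    (if A g then s g ^+ 2 else 0) *
      \sum_x (\prod_(k | grp k == g) q k (a k)) ^+ 2 / L g x a.
  rewrite /H big_sum3 /=; congr (_ + _ + _).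
    by apply: eq_bigr => x _; rewrite mul1r.
  rewrite -big_distrr /=; congr (_ * _); apply: eq_bigr => x _.
  by rewrite big_split /= prodrXl prodfV.
have HP a g : \sum_(x | A g ==> (x != sel a g)) L g x a <= H a g.
  rewrite HE; case: (A g) => /=; last by rewrite !mul0r !addr0.
  rewrite mulNr; apply: sum_but_one_le => // x /eqP.
  rewrite prodf_seq_eq0 => /hasP[k kin /andP[kg /eqP pk]].
  by rewrite (bigD1 k)//= (pq _ _ _ pk) mul0r.
rewrite (exchange_big_dep predT)//=.
apply: (@le_trans _ _ (\sum_a \prod_g H a g)).
  apply: ler_sum => a _.
  rewrite (eq_bigr (fun x : {ffun G -> X} => \prod_g L g (x g) a)); last first.
    by move=> x _; rewrite /L (prod_by_group grp (fun k g => p k (x g) (a k))).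
  rewrite (eq_bigl [in family (fun g => [pred x | A g ==> (x != sel a g)])]).
    rewrite -(bigA_distr_big_dep (fun g => [pred x | A g ==> (x != sel a g)])
                                 (fun g x => L g x a)).
    apply: ler_prod => g _; rewrite HP andbT.
    by apply: sumr_ge0 => x _; exact: L0.
  by move=> x; apply/forallP/familyP.
rewrite /H sum_prod_by_group.
have -> : #|X|%:R ^+ #|G| = \prod_(g : G) #|X|%:R :> R.
  by rewrite prodr_const.
rewrite [X in _ <= _ * X]big_mkcond /= -big_split /=.
apply: ler_prod => g _; rewrite big_sum3 /=.
rewrite (eq_bigr (fun=> 1)); last first.
  move=> x _; rewrite mul1r big1// => k _; exact: p1.
rewrite sumr_const big1 ?mulr1; last by move=> k _; exact: q1.
case: ifPn => Ag; last first.
  by rewrite big1 ?addr0 ?mulr1 ?lexx ?ler0n// => x _; exact: mul0r.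
rewrite -big_distrr /=; apply/andP; split.
  (* Comparing the products factor by factor requires nonnegative factors; [#|X| - 2 * s g] is one
     since [#|X| >= 2]. *)
  have s1 : s g <= 2^-1.
    by rewrite /s lef_pV2 ?posrE ?mulr_gt0// -[2]mulr1 ler_pM.
  apply: addr_ge0; first lra.
  rewrite mulr_ge0 ?sqr_ge0//; apply: sumr_ge0 => x _; apply: prodr_ge0 => k _.
  by apply: sumr_ge0 => y _; rewrite divr_ge0 ?sqr_ge0.
apply: (@le_trans _ _ (#|X|%:R - 2 * s g + s g ^+ 2 * (#|X|%:R * kap g))).
  rewrite lerD2l ler_wpM2l ?sqr_ge0//.
  rewrite mulr_natl -sumr_const; apply: ler_sum => x _; exact: hk.
rewrite le_eqVlt; apply/orP; left; apply/eqP; rewrite /s.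
by field; rewrite gt_eqF//= gt_eqF.
Qed.

Lemma bernoulli_ineq (R : realFieldType) (d : R) m :
  0 <= d <= 1 -> 1 - m%:R * d <= (1 - d) ^+ m.
Proof.
move=> /andP[d0 d1]; elim: m => [|m IH]; first by rewrite mul0r subr0.
rewrite exprS -natr1; have d1' : 0 <= 1 - d by lra.
apply: le_trans (ler_wpM2l d1' IH).
have : 0 <= m%:R * d ^+ 2 by rewrite mulr_ge0 ?sqr_ge0.
nra.
Qed.

(** * Seeds *)

(* Lower simple functions make the sum of the integrals a lower bound for the
   integral of the sum without any measurability of [f]. *)
Lemma exists_seed (R : realType) (d : measure_display) (T : measurableType d)
    (P : probability T R) (J : finType) (f : J -> T -> R) (Q : T -> Prop)
    (c c' : R) :
  (0 < #|J|)%N -> (forall j w, 0 <= f j w) ->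
  (forall j, (c%:E <= \int[P]_w (f j w)%:E)%E) ->
  {ae P, forall w, Q w} -> 0 <= c' -> c' < c ->
  exists2 w, Q w & c' * #|J|%:R < \sum_j f j w.
Proof.
move=> J0 f0 cf aeQ c'0 c'c; apply: contrapT => /forall2NP noQ.
pose m := (c' + c) / 2.
have c'm : c' < m by rewrite /m; lra.
have mc : m < c by rewrite /m; lra.
have /choice[h hP] j : exists h : {nnsfun T >-> R},
    (forall w, h w <= f j w) /\ (m%:E < \int[P]_w (h w)%:E)%E.
  have := cf j; rewrite ge0_integralTE; last by move=> w; rewrite lee_fin.
  move=> /(lt_le_trans _) => /(_ m%:E); rewrite lte_fin => /(_ mc).
  move=> /ereal_sup_gt[_ [h /= hf <-] mh]; exists h; split.
    by move=> w; rewrite -lee_fin; exact: hf.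
  by rewrite integralT_nnsfun.
have mh j : measurable_fun [set: T] (fun w => (h j w : R)%:E).
  by apply/measurable_EFinP.
have : (\sum_j \int[P]_w (h j w)%:E <= (c' * #|J|%:R)%:E)%E.
  rewrite -ge0_integral_sum//; last by move=> j w _; rewrite lee_fin.
  rewrite -[leRHS]mule1 -(@probability_setT _ _ _ P) -integral_cst//.
  apply: ae_ge0_le_integral => //.
  - by move=> w _; apply: sume_ge0 => j _; rewrite lee_fin.
  - exact: emeasurable_sum.
  - by move=> w _; rewrite /= lee_fin mulr_ge0.
  apply: filterS aeQ => w Qw _; rewrite sumEFin lee_fin.
  have [//|/negP] := noQ w; rewrite -leNgt; apply: le_trans.
  by apply: ler_sum => j _; have [+ _] := hP j; exact.
rewrite leNgt => /negP; apply.
apply: (@lt_le_trans _ _ (m * #|J|%:R)%:E).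
  by rewrite lte_fin ltr_pM2r// ltr0n.
rewrite mulr_natr -sumr_const -sumEFin; apply: lee_sum => j _.
by have [_ /ltW] := hP j.
Qed.

(** * Tiered models *)

Definition tilted_law (R : realFieldType) (I : finType) (u : I -> R)
    (T : {set I}) (i : I) : R :=
  if i \in T then u i / \sum_(j in T) u j else 0.

Lemma sum_tilted_law (R : realFieldType) (I : finType) (u : I -> R)
    (T : {set I}) :
  \sum_(j in T) u j != 0 -> \sum_i tilted_law u T i = 1.
Proof. by move=> U0; rewrite -big_mkcond -big_distrl /= divff. Qed.

(* Kantorovich's inequality: since [(u - 1) (1 + th - u) >= 0],
   [u + (1 + th) / u <= 2 + th]; sum this over [T] and apply AM-GM. *)
Lemma tilted_law_chi2 (R : realFieldType) (I : finType) (th : R) (u : I -> R)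
    (T : {set I}) :
  0 <= th -> (forall i, 1 <= u i <= 1 + th) -> (0 < #|T|)%N ->
  \sum_i tilted_law (fun=> 1) T i ^+ 2 / tilted_law u T i <=
    if (1 < #|T|)%N then 1 + th ^+ 2 else 1.
Proof.
move=> th0 u1 T0.
have u0 i : 0 < u i by have /andP[] := u1 i; lra.
set U := \sum_(j in T) u j; set V := \sum_(j in T) (u j)^-1.
pose t : R := #|T|%:R; have t0 : 0 < t by rewrite ltr0n.
have U0 : 0 < U.
  apply: lt_le_trans t0 _; rewrite /t -sumr_const; apply: ler_sum => i _.
  by have /andP[] := u1 i.
have -> : \sum_i tilted_law (fun=> 1) T i ^+ 2 / tilted_law u T i =
    U * V / t ^+ 2.
  rewrite /V big_distrr big_distrl /= [RHS]big_mkcond; apply: eq_bigr => i _.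
  rewrite /tilted_law sumr_const -/t; case: ifPn => iT; last by rewrite expr0n mul0r.
  by rewrite -/U; field; rewrite !gt_eqF.
case: ifPn => [_|]; last first.
  rewrite -leqNgt => T1; have /cards1P[i Ti] : #|T| == 1%N by lia.
  rewrite /U /V /t Ti !big_set1 cards1 divff ?gt_eqF//.
  by rewrite expr1n divr1.
have UV : U + (1 + th) * V <= (2 + th) * t.
  rewrite /U /V /t big_distrr -sumr_const big_distrr -big_split /=.
  apply: ler_sum => i _; rewrite mulr1; have /andP[ui1 ui2] := u1 i.
  rewrite -subr_ge0.
  have -> : 2 + th - (u i + (1 + th) / u i) = (u i - 1) * (1 + th - u i) / u i.
    by field; rewrite gt_eqF.
  by rewrite divr_ge0 ?mulr_ge0 ?(ltW (u0 i))//; lra.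
have V0 : 0 <= V by apply: sumr_ge0 => i _; rewrite invr_ge0 ltW.
have UVt : 4 * (1 + th) * (U * V) <= (2 + th) ^+ 2 * t ^+ 2.
  have W0 : 0 <= U + (1 + th) * V by rewrite addr_ge0 ?mulr_ge0//; lra.
  have : (U + (1 + th) * V) ^+ 2 <= ((2 + th) * t) ^+ 2.
    by rewrite lerXn2r// nnegrE; nra.
  have := sqr_ge0 (U - (1 + th) * V); rewrite exprMn; nra.
rewrite ler_pdivrMr ?exprn_gt0//.
have th4 : 0 < 4 * (1 + th) by lra.
rewrite -(ler_pM2l th4); apply: (le_trans UVt).
have t20 : 0 <= t ^+ 2 by exact: sqr_ge0.
(* [(2 + th) ^ 2 = 4 (1 + th) + th ^ 2 <= 4 (1 + th) (1 + th ^ 2)]. *)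
rewrite [leRHS]mulrA ler_wpM2r//; nra.
Qed.

Section TieredModel.
Context (R : realType) (n G K : nat) (pos : 'I_n -> option ('I_G * 'I_K)).
Implicit Types (S : slate n) (x : {ffun option 'I_G -> 'I_K}).

Definition tier (i : 'I_n) : option 'I_G := omap fst (pos i).

(** Items without a place form the tier [None], which lies above all the others. *)
Definition height (g : option 'I_G) : nat := if g is Some g then g else G.

Definition tilt (th : R) (z : 'I_K) (i : 'I_n) : R :=
  if pos i is Some (_, y) then if y == z then 1 + th else 1 else 1.

Lemma slate_ex S : exists i, i \in val S.
Proof. exact/finset.set0Pn/(valP S). Qed.

Definition top_tier S : option 'I_G :=
  tier [arg max_(i > xchoose (slate_ex S) in val S) height (tier i)].

Definition top S : {set 'I_n} := [set i in val S | tier i == top_tier S].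

Lemma height_inj : injective height.
Proof.
move=> [g|] [h|]//= E; first by congr Some; apply: val_inj.
- by have := ltn_ord g; rewrite E ltnn.
- by have := ltn_ord h; rewrite -E ltnn.
Qed.

Lemma top_ex S : exists2 i, i \in val S & tier i = top_tier S.
Proof.
rewrite /top_tier; case: arg_maxnP => [|i iS _]; first exact: xchooseP.
by exists i.
Qed.

Lemma height_top S i : i \in val S -> (height (tier i) <= height (top_tier S))%N.
Proof.
rewrite /top_tier; case: arg_maxnP => [|j _ + iS]; first exact: xchooseP.
exact.
Qed.

Lemma card_top_gt0 S : (0 < #|top S|)%N.
Proof.
have [i iS it] := top_ex S; apply/card_gt0P; exists i.
by rewrite inE iS it eqxx.
Qed.

Lemma tilt_bounds th z i : 0 <= th -> 1 <= tilt th z i <= 1 + th.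
Proof.
move=> th0; rewrite /tilt; case: (pos i) => [[_ y]|]; last lra.
by case: ifP => _; lra.
Qed.

Definition tiered_weight (B th : R) x i : R :=
  B ^+ height (tier i) * tilt th (x (tier i)) i.

Lemma tiered_weight_gt0 B th x : 0 < B -> 0 <= th ->
  forall i, 0 < tiered_weight B th x i.
Proof.
move=> B0 th0 i; rewrite mulr_gt0 ?exprn_gt0//.
by have /andP[+ _] := tilt_bounds (x (tier i)) i th0; lra.
Qed.

Definition tiered_mnl B th x (B0 : 0 < B) (th0 : 0 <= th) : mnl R n :=
  Mnl (tiered_weight_gt0 x B0 th0).

(* The law of an answer in the limit where [B] tends to infinity. *)
Definition limit_law th S (z : 'I_K) : 'I_n -> R := tilted_law (tilt th z) (top S).

(** The items below the top tier weigh together at most [n (1 + th) / B] times [B ^ h], against at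
    least [B ^ h] for the top tier. A one-sided bound suffices, since [success_sum_le] applies it to
    failures only. *)
Lemma limit_law_le B th x (B1 : 0 < B) (th0 : 0 <= th) S i :
  n%:R * (1 + th) <= B ->
  (1 - n%:R * (1 + th) / B) * limit_law th S (x (top_tier S)) i <=
  mnl_prob (tiered_mnl x B1 th0) S i.
Proof.
set dl := n%:R * (1 + th) / B => hB.
have dl1 : dl <= 1 by rewrite ler_pdivrMr// mul1r.
have dl0 : 0 <= dl by rewrite divr_ge0 ?mulr_ge0//; lra.
have n1 : 1 <= n%:R :> R by rewrite ler1n; case: (n) i => // -[].
have B1' : 1 <= B by apply: le_trans hB; nra.
have w0 := tiered_weight_gt0 x B1 th0.
rewrite /limit_law /tilted_law /mnl_prob inE.
case: (boolP (i \in val S)) => iS /=; last first.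
  by rewrite mulr0.
case: eqP => [it|_]; last first.
  rewrite mulr0; apply: divr_ge0; first exact/ltW/w0.
  by apply: sumr_ge0 => j _; exact/ltW/w0.
set h := height (top_tier S); set u := tilt th (x (top_tier S)).
set U := \sum_(j in top S) u j; set W := \sum_(j in _) _.
have u1 j : 1 <= u j <= 1 + th by exact: tilt_bounds.
have U1 : 1 <= U.
  have [j jS jt] := top_ex S; have jT : j \in top S by rewrite inE jS jt eqxx.
  rewrite /U (bigD1 j)//= -[1]addr0 lerD//; first by have /andP[] := u1 j.
  by apply: sumr_ge0 => k _; have /andP[+ _] := u1 k; lra.
have Bh0 : 0 < B ^+ h by rewrite exprn_gt0.
have WU : W <= B ^+ h * (U + dl).
  rewrite /W (bigID [in top S])/= mulrDr lerD//.
    rewrite big_distrr /= le_eqVlt; apply/orP; left; apply/eqP.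
    apply: eq_big => [j|j]; first by rewrite inE andbA andbb.
    by rewrite !inE => /and3P[_ _ /eqP jt]; rewrite /tiered_weight jt.
  apply: (@le_trans _ _ (\sum_(j : 'I_n) B ^+ h * (1 + th) / B)).
    rewrite big_mkcond /=; apply: ler_sum => j _.
    have r0 : 0 <= B ^+ h * (1 + th) / B.
      by rewrite divr_ge0 ?mulr_ge0 ?ltW//; lra.
    case: ifPn => // /andP[jS]; rewrite inE jS /= => jt.
    rewrite ler_pdivlMr// mulrAC; apply: ler_pM => //.
    - by rewrite mulr_ge0 ?exprn_ge0 ?ltW.
    - by have /andP[+ _] := tilt_bounds (x (tier j)) j th0; lra.
    - rewrite -exprSr ler_weXn2l//; 
      rewrite ltn_neqAle height_top// andbT.
      by apply: contra jt => /eqP/height_inj ->.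
    - by have /andP[] := tilt_bounds (x (tier j)) j th0.
  rewrite sumr_const card_ord -mulr_natl /dl le_eqVlt.
  by apply/orP; left; apply/eqP; ring.
have W0 : 0 < W.
  rewrite /W (bigD1 i)//= ltr_pwDl//.
  by apply: sumr_ge0 => j _; exact/ltW/w0.
rewrite ler_pdivlMr// -mulrA -mulrA mulrCA.
rewrite /tiered_weight it -/h -/u.
have ui0 : 0 <= u i by have /andP[+ _] := u1 i; lra.
rewrite [leRHS]mulrC ler_wpM2l// mulrC -mulrA ler_pdivrMl; last lra.
apply: (@le_trans _ _ (B ^+ h * (U + dl) * (1 - dl))).
  by rewrite ler_wpM2r//; lra.
rewrite -mulrA mulrC ler_pM2r//.
(* [(U + dl) (1 - dl) = U - dl (U - 1) - dl ^ 2]. *)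
have := mulr_ge0 dl0 (ltac:(lra) : 0 <= U - 1); have := sqr_ge0 dl; nra.
Qed.

Lemma dinfty_ge (M M' : mnl R n) S i :
  `|mnl_prob M S i - mnl_prob M' S i| <= dinfty M M'.
Proof.
apply: le_trans (le_bigmax _ _ S).
exact: (le_bigmax _ (fun i => `|mnl_prob M S i - mnl_prob M' S i|)).
Qed.

Lemma mnl_sum_gt0 (M : mnl R n) S : 0 < \sum_(j in val S) M j.
Proof.
have [i iS] := slate_ex S; rewrite (bigD1 i)//= ltr_pwDl ?mnl_weight_gt0//.
by apply: sumr_ge0 => j _; exact/ltW/mnl_weight_gt0.
Qed.

Lemma mnl_prob_ge0 (M : mnl R n) S i : 0 <= mnl_prob M S i.
Proof.
rewrite /mnl_prob; case: ifP => // _.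
by rewrite divr_ge0 ?ltW ?mnl_sum_gt0 ?mnl_weight_gt0.
Qed.

Lemma sum_mnl_prob (M : mnl R n) S : \sum_i mnl_prob M S i = 1.
Proof.
by rewrite -big_mkcond -big_distrl /= divff// gt_eqF ?mnl_sum_gt0.
Qed.

(* On the slate formed by a whole tier, [Mh] gives at most [1 / K] to some
   item, which is too little if that item is the tilted one. *)
Lemma excluded_tilt (B th eps : R) (B0 : 0 < B) (th0 : 0 <= th)
    (itm : 'I_G * 'I_K -> 'I_n) (Mh : mnl R n) (g : 'I_G) :
  (forall p, pos (itm p) = Some p) -> (0 < K)%N ->
  eps < (1 + th) / (K%:R + th) - K%:R^-1 ->
  exists y, forall x, dinfty (tiered_mnl x B0 th0) Mh <= eps -> x (Some g) != y.
Proof.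
move=> itmK K0 heps; pose S0 := [set itm (g, y) | y in 'I_K].
have itm_inj : injective (fun y => itm (g, y)).
  by move=> y z /(congr1 pos); rewrite !itmK => -[].
have S0P : S0 != finset.set0.
  by apply/finset.set0Pn; exists (itm (g, Ordinal K0)); exact: imset_f.
pose S : slate n := exist _ S0 S0P.
have K0' : 0 < K%:R :> R by rewrite ltr0n.
have sumS (F : 'I_n -> R) : \sum_(i in S0) F i = \sum_y F (itm (g, y)).
  by rewrite big_imset//= => y z _ _; exact: itm_inj.
(* Probabilities sum to 1, so some item of the tier gets at most [1 / K]. The choice depends on [Mh]
   alone and serves all [x] at once. *)
have [y hy] : exists y, mnl_prob Mh S (itm (g, y)) <= K%:R^-1.
  apply: contrapT => /forallNP hy.
  have : \sum_(y < K) K%:R^-1 < \sum_y mnl_prob Mh S (itm (g, y)).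
    apply: ltr_sum => [|y _]; last by have /negP := hy y; rewrite -ltNge.
    by apply/hasP; exists (Ordinal K0); rewrite ?mem_index_enum.
  rewrite sumr_const card_ord -[X in X < _]mulr_natl divff ?gt_eqF// -sumS.
  rewrite -(sum_mnl_prob Mh S) (bigID [in S0])/= [X in _ + X]big1 ?addr0 ?ltxx//.
  by move=> i /negPf iS; rewrite /mnl_prob /= iS.
exists y => x; apply: contraTN => /eqP xg; rewrite -ltNge.
apply: (lt_le_trans heps); apply: le_trans (dinfty_ge _ _ S (itm (g, y))).
apply: le_trans (ler_norm _); rewrite lerB// /mnl_prob /= imset_f//.
rewrite sumS /tiered_weight.
have tg z : tier (itm (g, z)) = Some g by rewrite /tier itmK.
rewrite (eq_bigr (fun z => B ^+ g * (if z == y then 1 + th else 1))); last first.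
  by move=> z _; rewrite tg /tilt itmK xg.
rewrite -big_distrr /= tg /tilt itmK xg eqxx (bigD1 y)//= eqxx.
rewrite (eq_bigr (fun=> 1)) => [|z /negPf ->//].
rewrite sumr_const cardC1 card_ord -mulf_div divff ?mul1r ?gt_eqF ?exprn_gt0//.
have -> : K%:R = 1 + K.-1%:R :> R by rewrite -{1}(prednK K0) -natr1 addrC.
by rewrite addrAC.
Qed.

(** Under the limit law, a slate with a single top item has a sure answer, which says nothing about
    the tilts. *)
Definition informative (g : 'I_G) S : bool :=
  (top_tier S == Some g) && (1 < #|top S|)%N.

(** The success probability for one seed, freed from the algorithm so that [s] and [out] are
    arbitrary. *)
Definition success_given_queries (eps : R) (M : mnl R n) (s : seq (slate n))
    (out : seq 'I_n -> mnl R n) : R :=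
  \sum_(a : (size s).-tuple 'I_n | dinfty M (out a) <= eps) answers_prob M a.

Lemma answers_prob_ffun (M : mnl R n) (s : seq (slate n))
    (a : (size s).-tuple 'I_n) :
  answers_prob M a = \prod_k mnl_prob M (tnth (in_tuple s) k) (tnth a k).
Proof.
rewrite /answers_prob.
rewrite -[zip s a]/(tval (zip_tuple (in_tuple s) a)) big_tuple.
apply: eq_bigr => k _; have i0 : 'I_n by exact: (tnth a k).
have S0 : slate n by exact: (tnth (in_tuple s) k).
rewrite (tnth_nth (S0, i0)) nth_zip /=; last by rewrite size_tuple.
by rewrite (tnth_nth S0) (tnth_nth i0).
Qed.

Lemma sum_tuple_ffun m (P : pred (seq 'I_n)) (F : m.-tuple 'I_n -> R) :
  \sum_(a : m.-tuple 'I_n | P a) F a =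
  \sum_(a : {ffun 'I_m -> 'I_n} | P [tuple a k | k < m]) F [tuple a k | k < m].
Proof.
apply: (reindex (fun a : {ffun 'I_m -> 'I_n} => [tuple a k | k < m])).
exists (fun t : m.-tuple 'I_n => [ffun k => tnth t k]) => a _.
  by apply/ffunP => k; rewrite ffunE tnth_mktuple.
by apply: eq_from_tnth => k; rewrite tnth_mktuple ffunE.
Qed.

Lemma limit_law_ge0 th S z i : 0 <= th -> 0 <= limit_law th S z i.
Proof.
move=> th0; have u0 j : 0 <= tilt th z j.
  by have /andP[+ _] := tilt_bounds z j th0; lra.
by rewrite /limit_law /tilted_law; case: ifP => // _; rewrite divr_ge0// sumr_ge0.
Qed.

Lemma tilt_top_gt0 th S z : 0 <= th -> 0 < \sum_(j in top S) tilt th z j.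
Proof.
move=> th0; apply: (@lt_le_trans _ _ (\sum_(j in top S) 1)).
  by rewrite sumr_const ltr0n card_top_gt0.
by apply: ler_sum => j _; have /andP[] := tilt_bounds z j th0.
Qed.

Lemma sum_limit_law th S z : 0 <= th -> \sum_i limit_law th S z i = 1.
Proof. by move=> th0; rewrite sum_tilted_law// gt_eqF ?tilt_top_gt0. Qed.

(* Uniform answers play the role of the reference law of
   [direct_product_bound]. *)
Lemma sum_limit_success_le (th : R) (s : seq (slate n))
    (sel : {ffun 'I_(size s) -> 'I_n} -> 'I_G -> 'I_K) :
  0 <= th -> (1 < K)%N ->
  \sum_(x : {ffun option 'I_G -> 'I_K}) \sum_(a : {ffun 'I_(size s) -> 'I_n}
                 | [forall g, x (Some g) != sel a g])
      \prod_k limit_law th (tnth (in_tuple s) k)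
                (x (top_tier (tnth (in_tuple s) k))) (a k)
  <= K%:R ^+ G.+1 *
     \prod_(g < G) (1 - (K%:R ^+ 2 * (1 + th ^+ 2) ^+ count (informative g) s)^-1).
Proof.
move=> th0 K1; have z0 : 'I_K by exact: Ordinal (ltnW K1).
have th2 : 1 <= 1 + th ^+ 2 by rewrite lerDl sqr_ge0.
pose Sk k := tnth (in_tuple s) k.
pose kap g := if g is Some g then (1 + th ^+ 2) ^+ count (informative g) s else 1.
pose sel' a g := if g is Some g then sel a g else z0.
have := @direct_product_bound R _ _ _ _ (fun k => top_tier (Sk k)) isSome
  (fun k => tilted_law (fun=> 1) (top (Sk k))) (fun k => limit_law th (Sk k))
  kap sel'.
rewrite !card_ord card_option card_ord => H.
rewrite (_ : \prod_(g < G) _ = \prod_(g | isSome g) (1 - (K%:R ^+ 2 * kap g)^-1)).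
  apply: le_trans (H _ _ _ _ _ _ _) => //.
  - rewrite le_eqVlt; apply/orP; left; apply/eqP; apply: eq_bigr => x _.
    apply: eq_bigl => a; apply/forallP/forallP => [h [g|]|h g].
    + exact: h.
    + by [].
    + exact: (h (Some g)).
  - by move=> k z i; exact: limit_law_ge0.
  - move=> k z i; rewrite /limit_law /tilted_law; case: ifP => // _ /eqP.
    rewrite mulf_eq0 invr_eq0 (gt_eqF (tilt_top_gt0 _ _ th0)) orbF => /eqP u0.
    by have := tilt_bounds z i th0; rewrite u0 ler10.
  - by move=> k; rewrite sum_tilted_law// sumr_const pnatr_eq0 -lt0n card_top_gt0.
  - by move=> k z; exact: sum_limit_law.
  - by case=> [g|]//; exact: exprn_ege1.
  case=> // g z _; rewrite /kap.
  have -> : (1 + th ^+ 2) ^+ count (informative g) s =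
      \prod_(S <- s | top_tier S == Some g)
        if (1 < #|top S|)%N then 1 + th ^+ 2 else 1.
    by rewrite -big_mkcondr big_const_seq iter_mulr_1.
  rewrite [leRHS]big_tnth; apply: ler_prod => k _; apply/andP; split.
    apply: sumr_ge0 => i _; rewrite divr_ge0 ?sqr_ge0//.
    exact: limit_law_ge0.
  apply: tilted_law_chi2 => //; first by move=> i; exact: tilt_bounds.
  exact: card_top_gt0.
rewrite [RHS](reindex_omap Some id) => [|[g|]]//.
by apply: eq_bigl => g; rewrite /= eqxx.
Qed.

(** By Bernoulli's inequality, every vector of answers keeps at least half of its limit probability.
    Failure thus keeps half of its limit probability, and success has probability at most 1/2 plus
    half of its own. *)
Lemma success_sum_le (B th eps : R) (B0 : 0 < B) (th0 : 0 <= th)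
    (itm : 'I_G * 'I_K -> 'I_n) (s : seq (slate n)) (out : seq 'I_n -> mnl R n) :
  (forall p, pos (itm p) = Some p) -> (1 < K)%N ->
  eps < (1 + th) / (K%:R + th) - K%:R^-1 ->
  n%:R * (1 + th) <= B -> (size s)%:R * (n%:R * (1 + th) / B) <= 2^-1 ->
  \sum_x success_given_queries eps (tiered_mnl x B0 th0) s out <=
  K%:R ^+ G.+1 * (2^-1 + 2^-1 *
     \prod_(g < G) (1 - (K%:R ^+ 2 * (1 + th ^+ 2) ^+ count (informative g) s)^-1)).
Proof.
move=> itmK K1 heps hB hs.
set dl := n%:R * (1 + th) / B in hs.
have dl01 : 0 <= dl <= 1.
  by rewrite ler_pdivrMr// mul1r hB divr_ge0 ?mulr_ge0//; lra.
have /choice[sel selP] (ag : {ffun 'I_(size s) -> 'I_n} * 'I_G) :=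
  excluded_tilt B0 th0 (out [tuple ag.1 k | k < size s]) ag.2 itmK (ltnW K1) heps.
pose Sk k := tnth (in_tuple s) k.
pose L x (a : {ffun 'I_(size s) -> 'I_n}) :=
  \prod_k limit_law th (Sk k) (x (top_tier (Sk k))) (a k).
pose W (x : {ffun option 'I_G -> 'I_K}) (a : {ffun 'I_(size s) -> 'I_n}) :=
  \prod_k mnl_prob (tiered_mnl x B0 th0) (Sk k) (a k).
have L0 x a : 0 <= L x a by apply: prodr_ge0 => k _; exact: limit_law_ge0.
have W1 x : \sum_a W x a = 1.
  rewrite -(bigA_distr_bigA (fun k => mnl_prob (tiered_mnl x B0 th0) (Sk k))).
  by rewrite big1// => k _; exact: sum_mnl_prob.
have L1 x : \sum_a L x a = 1.
  rewrite -(bigA_distr_bigA (fun k => limit_law th (Sk k) (x (top_tier (Sk k))))).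
  by rewrite big1// => k _; exact: sum_limit_law.
have LW x a : 2^-1 * L x a <= W x a.
  apply: (@le_trans _ _ ((1 - dl) ^+ size s * L x a)).
    by rewrite ler_wpM2r//; have := bernoulli_ineq (size s) dl01; lra.
  rewrite -[X in _ ^+ X]card_ord -prodr_const -big_split /=.
  apply: ler_prod => k _; rewrite mulr_ge0 ?limit_law_ge0 ?limit_law_le//; lra.
have half x : success_given_queries eps (tiered_mnl x B0 th0) s out <=
    2^-1 + 2^-1 * \sum_(a | [forall g, x (Some g) != sel (a, g)]) L x a.
  pose good (a : {ffun 'I_(size s) -> 'I_n}) :=
    dinfty (tiered_mnl x B0 th0) (out [tuple a k | k < size s]) <= eps.
  have -> : success_given_queries eps (tiered_mnl x B0 th0) s out =
      \sum_(a | good a) W x a.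
    rewrite /success_given_queries.
    rewrite (sum_tuple_ffun (fun a => dinfty (tiered_mnl x B0 th0) (out a) <= eps)).
    apply: eq_bigr => a _; rewrite answers_prob_ffun.
    by apply: eq_bigr => k _; rewrite tnth_mktuple.
  have gW : \sum_(a | good a) W x a + \sum_(a | ~~ good a) W x a = 1.
    by rewrite -[RHS](W1 x) [RHS](bigID good).
  have gL : \sum_(a | good a) L x a + \sum_(a | ~~ good a) L x a = 1.
    by rewrite -[RHS](L1 x) [RHS](bigID good).
  have bLW : 2^-1 * \sum_(a | ~~ good a) L x a <= \sum_(a | ~~ good a) W x a.
    by rewrite big_distrr /=; apply: ler_sum => a _; exact: LW.
  have : \sum_(a | good a) L x a <=
      \sum_(a | [forall g, x (Some g) != sel (a, g)]) L x a.
    rewrite big_mkcond [leRHS]big_mkcond; apply: ler_sum => a _.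
    case: ifPn => ga; last by case: ifP.
    case: ifPn => // /forallPn[g]; rewrite (selP (a, g))//.
  lra.
apply: le_trans (ler_sum _ (fun x _ => half x)) _.
rewrite big_split /= sumr_const -big_distrr /= card_ffun card_ord card_option.
rewrite card_ord -[2^-1 *+ _]mulr_natl natrX mulrDr lerD// mulrCA ler_wpM2l//.
exact: (sum_limit_success_le (fun a g => sel (a, g))).
Qed.
End TieredModel.

(** * Random tiers *)

Lemma agree_count (C : finType) (D : {set C}) (beta : C -> bool) :
  (#|[set b : {ffun C -> bool} | [forall c in D, b c == beta c]]| * 2 ^ #|D| =
   2 ^ #|C|)%N.
Proof.
pose F c : pred bool := fun x => (c \in D) ==> (x == beta c).
have -> : #|[set b : {ffun C -> bool} | [forall c in D, b c == beta c]]| =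
    #|family F|.
  apply: eq_card => b; rewrite inE; apply/forall_inP/familyP => h c.
    by apply/implyP; exact: h.
  by move=> cD; have /implyP := h c; exact.
rewrite card_family foldrE big_image /= -prod_nat_const [X in (_ * X)%N]big_mkcond.
have -> : (2 ^ #|C| = \prod_(c : C) 2)%N by rewrite prod_nat_const.
rewrite -big_split /=.
apply: eq_bigr => c _; rewrite /F; case: (c \in D) => /=.
  by rewrite (eq_card (_ : _ =i pred1 (beta c))) ?card1.
by rewrite -[RHS]card_bool muln1; apply: eq_card.
Qed.

(** By symmetry the count is the same for every [x != c] in place of [c']. Summed over [x], each [t]
    contributes at most the size [K] of a fibre of [f]. Hence a collision probability of at most
    [K / (#|C| - 1)]. *)
Lemma collision_count (C T : finType) (f : C -> T) (K : nat) (c c' : C) :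
  (forall g, #|[pred p | f p == g]| <= K)%N -> c != c' ->
  (#|C|.-1 * #|[set t : {perm C} | f (t c) == f (t c')]| <= #|{perm C}| * K)%N.
Proof.
move=> hK cc'; pose N x := #|[set t : {perm C} | f (t c) == f (t x)]|.
have NE x : x != c -> N x = N c'.
  move=> xc; rewrite /N.
  (* Precomposing with the transposition of [x] and [c'], which fixes [c], maps one set onto the
     other. *)
  rewrite -(card_imset _ (mulgI (tperm x c'))); apply: eq_card => t.
  apply/imsetP/idP => [[u]|].
    rewrite !inE => hu ->; rewrite !permM tpermR.
    by rewrite tpermD// eq_sym.
  rewrite inE => ht; exists ((tperm x c') * t)%g.
    by rewrite inE !permM tpermL tpermD// eq_sym.
  by rewrite mulgA tperm2 mul1g.
rewrite -/(N c').
have -> : (#|C|.-1 * N c' = \sum_(x | x != c) N x)%N.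
  rewrite (eq_bigr (fun=> N c')) => [|x /NE//].
  by rewrite sum_nat_const cardC1.
rewrite (_ : \sum_(x | x != c) N x =
  \sum_(t : {perm C}) \sum_(x | x != c) (f (t c) == f (t x)))%N; last first.
  rewrite exchange_big /=; apply: eq_bigr => x _.
  by rewrite /N -sum1_card big_mkcond; apply: eq_bigr => t _; rewrite inE; case: eqP.
rewrite -sum_nat_const; apply: leq_sum => t _; apply: leq_trans (hK (f (t c))).
apply: (@leq_trans (\sum_x (f (t c) == f (t x)))).
  by rewrite big_mkcond; apply: leq_sum => x _; case: ifP.
rewrite (reindex_perm t^-1) /= -sum1_card [leqRHS]big_mkcond /=.
by apply: leq_sum => x _; rewrite inE permKV eq_sym; case: eqP.
Qed.

(** From 3 on, adding 1 to [m] at most doubles the square. This lets the small chance that all coins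
    agree absorb the number of pairs of couples. *)
Lemma sqr_le_exp2 m : (m ^ 2 <= 4 * 2 ^ m)%N.
Proof.
elim: m => // -[//|[//|[//|m]]] IH.
have : (m.+4 ^ 2 <= 2 * m.+3 ^ 2)%N by rewrite -!mulnn; nia.
rewrite (expnS 2 m.+3); lia.
Qed.

Section RandomTiers.
Context (R : realType) (n G K : nat).
Local Notation C := ('I_G * 'I_K)%type.
Context (e : bool * C -> 'I_n) (e_inj : injective e).
Implicit Types (b : {ffun C -> bool}) (t : {perm C}) (S : slate n).

(* One item of each couple [(e (true, c), e (false, c))] gets a place in the
   low tiers, the coin [b c] deciding which one. *)
Definition place b t (i : 'I_n) : option C :=
  if [pick v | e v == i] is Some (d, c) then
    if d == b c then Some (t c) else None
  else None.

Lemma placeE b t d c : place b t (e (d, c)) = if d == b c then Some (t c) else None.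
Proof.
rewrite /place; case: pickP => [v /eqP/e_inj ->//|/(_ (d, c))].
by rewrite eqxx.
Qed.

Lemma place_Some b t i p : place b t i = Some p ->
  exists2 c, i = e (b c, c) & p = t c.
Proof.
rewrite /place; case: pickP => // -[d c] /eqP <-.
by case: eqP => // -> [<-]; exists c.
Qed.

Definition item_at b t (p : C) : 'I_n := let c := (t^-1)%g p in e (b c, c).

Lemma item_atK b t p : place b t (item_at b t p) = Some p.
Proof. by rewrite placeE eqxx permKV. Qed.

Definition couples S : {set C} :=
  [set c | (e (true, c) \in val S) || (e (false, c) \in val S)].

(** An item outside the low tiers would be on top, so each item of [S] is the one selected by its
    coin, and [S] determines the coins of the couples it meets. Two top items then come from
    distinct couples sent to one tier. *)
Lemma informative_couples b t g S : informative (place b t) g S ->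
  [forall c in couples S, b c == (e (true, c) \in val S)] /\
  exists c c', [/\ c \in couples S, c' \in couples S, c != c' &
                   (t c).1 == (t c').1].
Proof.
move=> /andP[/eqP topg /card_gt1P[i [j [iT jT ij]]]].
have low k : k \in val S -> exists2 c, k = e (b c, c) & place b t k = Some (t c).
  move=> kS; case E : (place b t k) => [p|].
    by have [c kE ->] := place_Some E; exists c.
  have := height_top (place b t) kS.
  by rewrite topg /tier E /= leqNgt ltn_ord.
split.
  apply/forall_inP => c; rewrite inE; case: (boolP (e (true, c) \in _)) => /= [cS _|_ cS].
    by have [c' /e_inj[-> ->] _] := low _ cS.
  by have [c' /e_inj[-> ->] _] := low _ cS.
have couplesP k c : k \in val S -> k = e (b c, c) -> c \in couples S.
  by move=> kS kE; rewrite inE; case: (b c) kE => <-; rewrite kS ?orbT.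
move: iT jT; rewrite !inE topg => /andP[iS /eqP it] /andP[jS /eqP jt].
have [c ic pc] := low _ iS; have [c' jc pc'] := low _ jS.
exists c, c'; split; [exact: couplesP ic|exact: couplesP jc| |].
  by apply: contraNneq ij => cc'; rewrite ic jc cc'.
by move: it jt; rewrite /tier pc pc' => -[->] [->].
Qed.

(** A slate has one top tier, so it is informative for at most one [g]; when it is, the right side
    counts at least one colliding pair. *)
Lemma sum_informative_le b t S : (\sum_g informative (place b t) g S <=
  [forall c in couples S, b c == (e (true, c) \in val S)] *
  \sum_(c in couples S) \sum_(c' in couples S | c' != c)
     ((t c).1 == (t c').1))%N.
Proof.
have [/existsP[g gS]|/existsPn noS] := boolP [exists g, informative (place b t) g S];
  last by rewrite big1// => g _; rewrite (negPf (noS g)).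
have [-> [c [c' [cS c'S cc' tcc']]]] := informative_couples gS.
rewrite (bigD1 g)//= big1 => [|h hg]; last first.
  apply/eqP; rewrite eqb0; apply: contra hg => /andP[/eqP h1 _].
  by move: gS => /andP[/eqP + _]; rewrite h1 => -[->].
rewrite gS mul1n (bigD1 c)//= (bigD1 c')/=; last by rewrite c'S eq_sym.
by rewrite tcc'.
Qed.

(** Coins and permutation are independent. If [S] meets [k] couples, the coins agree with
    probability [2 ^ - k], each of at most [k ^ 2] pairs collides with probability at most
    [K / (#|C| - 1)], and [k ^ 2 <= 4 * 2 ^ k]. *)
Lemma count_informative_le S :
  (#|{: C}|.-1 * \sum_b \sum_t \sum_g informative (place b t) g S <=
   4 * K * #|{ffun C -> bool}| * #|{perm C}|)%N.
Proof.
set D := couples S.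
pose agree b := [forall c in D, b c == (e (true, c) \in val S)].
pose N c c' := #|[set t : {perm C} | (t c).1 == (t c').1]|.
have hN c c' : c' != c -> (#|{: C}|.-1 * N c c' <= #|{perm C}| * K)%N.
  rewrite eq_sym => cc'; apply: (collision_count (f := fst)) cc' => g.
  have snd_inj : {in [pred p : C | p.1 == g] &, injective snd}.
    by move=> [g1 y1] [g2 y2]; rewrite !inE /= => /eqP -> /eqP -> ->.
  by rewrite -(card_in_image snd_inj) -[leqRHS]card_ord max_card.
have hS b : (#|{: C}|.-1 * \sum_t \sum_g informative (place b t) g S <=
    agree b * (#|D| ^ 2 * (#|{perm C}| * K)))%N.
  apply: (@leq_trans (#|{: C}|.-1 * (agree b *
      \sum_(c in D) \sum_(c' in D | c' != c) N c c'))).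
    rewrite leq_mul2l; apply/orP; right.
    have -> : (\sum_(c in D) \sum_(c' in D | c' != c) N c c' =
        \sum_(t : {perm C}) \sum_(c in D) \sum_(c' in D | c' != c)
          ((t c).1 == (t c').1))%N.
      rewrite exchange_big; apply: eq_bigr => c _.
      rewrite exchange_big; apply: eq_bigr => c' _.
      by rewrite /N -sum1_card big_mkcond; apply: eq_bigr => t _; rewrite inE; case: eqP.
    rewrite big_distrr; apply: leq_sum => t _; exact: sum_informative_le.
  rewrite mulnCA leq_mul2l; apply/orP; right.
  rewrite -mulnn -mulnA -[leqRHS]sum_nat_const big_distrr; apply: leq_sum => c _.
  rewrite -[leqRHS]sum_nat_const big_distrr [leqRHS](bigID (fun c' => c' != c))/=.
  apply: leq_trans (leq_addr _ _); apply: leq_sum => c' /andP[_ cc'].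
  exact: hN.
apply: (@leq_trans (\sum_b agree b * (#|D| ^ 2 * (#|{perm C}| * K)))).
  by rewrite big_distrr; apply: leq_sum => b _; exact: hS.
rewrite -big_distrl /= (_ : \sum_b agree b = #|[set b | agree b]|)%N; last first.
  by rewrite -sum1_card [RHS]big_mkcond; apply: eq_bigr => b _; rewrite inE; case: (agree b).
have := agree_count D (fun c => e (true, c) \in val S); rewrite -/agree => hA.
have := sqr_le_exp2 #|D|; rewrite card_ffun card_bool -hA.
set a := #|[set b | agree b]|; set P := #|{perm C}|.
move: (2 ^ #|D|)%N (#|D| ^ 2)%N => u v uv.
have := leq_mul (leqnn (a * (P * K))) uv; nia.
Qed.
End RandomTiers.

(** * The lower bound *)

(* Linearising [expR (- th ^ 2 * m g)] at [- t] leaves only the sum of the [m g]. *)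
Lemma prod_small (R : realType) (G : nat) (m : 'I_G -> nat) (k th t : R) :
  1 <= k -> 0 < t -> (0 < G)%N -> 9 * (k * expR t) <= G%:R ->
  \prod_g (1 - (k * (1 + th ^+ 2) ^+ m g)^-1) <=
  10^-1 + th ^+ 2 * (\sum_g m g)%N%:R / (G%:R * t).
Proof.
move=> k1 t0 G0 hG; have k0 : 0 < k by lra.
have G0' : 0 < G%:R :> R by rewrite ltr0n.
have th2 : 0 <= th ^+ 2 by exact: sqr_ge0.
have kap1 g : 1 <= (1 + th ^+ 2) ^+ m g by rewrite exprn_ege1// lerDl.
have kk g : 1 <= k * (1 + th ^+ 2) ^+ m g.
  by rewrite mulr_ege1.
have f01 g : 0 <= 1 - (k * (1 + th ^+ 2) ^+ m g)^-1 <= 1.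
  have : (k * (1 + th ^+ 2) ^+ m g)^-1 <= 1 by rewrite invf_le1//; exact: lt_le_trans (kk g).
  have : 0 <= (k * (1 + th ^+ 2) ^+ m g)^-1 by rewrite invr_ge0; apply: le_trans (kk g).
  lra.
set M := (\sum_g m g)%N%:R.
have M0 : 0 <= M by exact: ler0n.
have [many|few] := ltP (G%:R * t) (th ^+ 2 * M).
  apply: (@le_trans _ _ (\prod_(g < G) 1)); first exact: ler_prod.
  rewrite big1_eq.
  have : 1 <= th ^+ 2 * M / (G%:R * t) by rewrite ler_pdivlMr ?mulr_gt0// mul1r ltW.
  lra.
apply: (@le_trans _ _ 10^-1); last first.
  by rewrite lerDl; apply: divr_ge0; [exact: mulr_ge0|exact/ltW/mulr_gt0].
have hr g : (k * expR t)^-1 * (1 + t - th ^+ 2 * (m g)%:R) <=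
    (k * (1 + th ^+ 2) ^+ m g)^-1.
  rewrite !invfM -expRN -mulrA ler_pM2l ?invr_gt0//.
  apply: (@le_trans _ _ (expR (- (th ^+ 2 * (m g)%:R)))).
    rewrite -[in leRHS](addKr t (- _)) expRD ler_wpM2l ?expR_ge0//.
    by rewrite -addrA expR_ge1Dx.
  rewrite expRN lef_pV2 ?posrE ?expR_gt0//; last exact: lt_le_trans (kap1 g).
  by rewrite expRM_natr lerXn2r ?nnegrE ?expR_ge0 ?expR_ge1Dx//; lra.
apply: (@le_trans _ _ (expR (- \sum_g (k * (1 + th ^+ 2) ^+ m g)^-1))).
  rewrite -sumrN expR_sum; apply: ler_prod => g _.
  by have /andP[-> _] := f01 g; exact: expR_ge1Dx.
(* By [few], the linearised terms sum to at least [G / (k * expR t)], which [hG] makes at least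
   9. *)
have h9 : 9 <= \sum_g (k * (1 + th ^+ 2) ^+ m g)^-1.
  apply: le_trans (ler_sum _ (fun g _ => hr g)).
  rewrite -big_distrr /= big_split /= sumr_const card_ord sumrN -big_distrr /=.
  rewrite -natr_sum -/M mulrC ler_pdivlMr ?mulr_gt0 ?expR_gt0//.
  by apply: (le_trans hG); rewrite -mulr_natl; lra.
(* Nine is enough because [expR 9 >= 1 + 9]. *)
rewrite expRN -[leRHS]invrK lef_pV2 ?posrE ?expR_gt0 ?invr_gt0//.
apply: le_trans (expR_ge1Dx _); lra.
Qed.

(** Non-adaptivity enters here: one list [s] faces all instances. The bound for given tiers is
    linear in the number [m b t] of informative queries, so only its average matters, and the total
    is at most [1/2 + 1/2 (1/10 + 1/10) = 6/10]. *)
Lemma average_success_le (R : realType) (n G K : nat)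
    (e : bool * ('I_G * 'I_K) -> 'I_n) (B th eps tau : R)
    (B0 : 0 < B) (th0 : 0 <= th) (s : seq (slate n))
    (out : seq 'I_n -> mnl R n) :
  injective e -> (1 < K)%N -> (1 < G)%N ->
  eps < (1 + th) / (K%:R + th) - K%:R^-1 ->
  n%:R * (1 + th) <= B -> (size s)%:R * (n%:R * (1 + th) / B) <= 2^-1 ->
  0 < tau -> 9 * (K%:R ^+ 2 * expR tau) <= G%:R ->
  th ^+ 2 * (size s)%:R * (4 * K%:R) <=
    10^-1 * (G%:R * tau * (G%:R * K%:R - 1)) ->
  \sum_b \sum_t \sum_x
     success_given_queries eps (tiered_mnl (place e b t) x B0 th0) s out <=
  6 / 10 *
  #|{: {ffun 'I_G * 'I_K -> bool} * {perm 'I_G * 'I_K}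
       * {ffun option 'I_G -> 'I_K}}|%:R.
Proof.
move=> e_inj K1 G1 heps hB hs tau0 hG hq.
set nb := #|{ffun 'I_G * 'I_K -> bool}|; set np := #|{perm 'I_G * 'I_K}|.
have K0 : 1 < K%:R :> R by rewrite ltr1n.
have G0 : 1 < G%:R :> R by rewrite ltr1n.
have GK1 : 1 < G%:R * K%:R :> R by nra.
pose m b t := (\sum_g count (informative (place e b t) g) s)%N.
pose M := (\sum_b \sum_t m b t)%N.
have hM : (G%:R * K%:R - 1) * M%:R <=
    (size s)%:R * (4 * K%:R) * (nb%:R * np%:R) :> R.
  have -> : G%:R * K%:R - 1 = (G * K).-1%:R :> R.
    by rewrite -subn1 natrB ?natrM// muln_gt0 (ltnW G1) (ltnW K1).
  rewrite -!natrM ler_nat.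
  have -> : M = (\sum_(S <- s) \sum_b \sum_t
      \sum_g informative (place e b t) g S)%N.
    rewrite /M /m [RHS]exchange_big /=; apply: eq_bigr => b _.
    rewrite [RHS]exchange_big /=; apply: eq_bigr => t _.
    rewrite [RHS]exchange_big /=; apply: eq_bigr => g _.
    by rewrite -sum1_count big_mkcond; apply: eq_bigr => S _; case: informative.
  rewrite big_distrr -sum1_size !big_distrl /=; apply: leq_sum => S _.
  have := count_informative_le e_inj S.
  by rewrite card_prod !card_ord mul1n -mulnA.
have step b t : \sum_x
     success_given_queries eps (tiered_mnl (place e b t) x B0 th0) s out <=
    K%:R ^+ G.+1 *
    (2^-1 + 2^-1 * (10^-1 + th ^+ 2 * (m b t)%:R / (G%:R * tau))).
  apply: (le_trans (success_sum_le _ _ _ (item_atK e_inj b t) K1 heps hB hs)).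
  rewrite ler_wpM2l ?exprn_ge0 ?ler0n// lerD2l ler_wpM2l ?invr_ge0//.
  apply: prod_small => //; last exact: ltnW.
  by rewrite exprn_ege1// ltW.
apply: le_trans (ler_sum _ (fun b _ => ler_sum _ (fun t _ => step b t))) _.
pose kG : R := K%:R ^+ G.+1; pose r := th ^+ 2 / (G%:R * tau).
rewrite (eq_bigr (fun b => \sum_t (kG * (11 / 20) + kG * r / 2 * (m b t)%:R)));
  last by move=> b _; apply: eq_bigr => t _; rewrite /kG /r; field; rewrite !gt_eqF//; lra.
rewrite (eq_bigr (fun b => kG * (11 / 20) * np%:R +
    kG * r / 2 * (\sum_t m b t)%N%:R)); last first.
  by move=> b _; rewrite big_split /= sumr_const -[X in X + _]mulr_natr -big_distrr /= natr_sum.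
rewrite big_split /= sumr_const -[X in X + _]mulr_natr -big_distrr -natr_sum -/M /=.
rewrite !card_prod -/nb -/np card_ffun card_ord card_option card_ord.
rewrite !natrM natrX -/kG.
have kG0 : 0 < kG by rewrite exprn_gt0//; lra.
have N0 : 0 <= nb%:R * np%:R :> R by rewrite mulr_ge0.
have Gt0 : 0 < G%:R * tau by rewrite mulr_gt0//; lra.
have gk0 : 0 < G%:R * K%:R - 1 :> R by lra.
have r0 : 0 <= r by rewrite divr_ge0 ?sqr_ge0 ?(ltW Gt0).
have rM : r * M%:R <= 10^-1 * (nb%:R * np%:R).
  rewrite -(ler_pM2l gk0) mulrCA; apply: le_trans (ler_wpM2l r0 hM) _.
  rewrite [leLHS]mulrA [leRHS]mulrA ler_wpM2r// /r mulrAC ler_pdivrMr//.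
  by lra.
have := ler_wpM2l (ltW kG0) rM.
nra.
Qed.

Lemma success_given_queries_ge0 (R : realType) (n : nat) (eps : R)
    (M : mnl R n) (s : seq (slate n)) (out : seq 'I_n -> mnl R n) :
  0 <= success_given_queries eps M s out.
Proof.
apply: sumr_ge0 => a _; rewrite answers_prob_ffun.
by apply: prodr_ge0 => k _; exact: mnl_prob_ge0.
Qed.

(* The hidden constants may depend only on a bound eps1 < 1 on eps: with no such
   bound the claim fails, since for eps >= 1 - 1/n (n >= 2) the uniform MNL is
   a correct answer obtained with no query at all. *)
Theorem theorem4p8 (R : realType) (eps1 : R) (heps1 : eps1 < 1) :
  exists (c : R) (N : nat), 0 < c /\
    forall (n : nat) (eps : R) (d : measure_display) (T : measurableType d)
      (A : nonadaptive_algorithm R n T) (q : nat),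
      (N <= n)%N -> 0 < eps -> eps <= eps1 ->
      learns_mnl A eps -> makes_at_most A q ->
      c * (n%:R ^+ 2 / eps ^+ 2 * ln n%:R) <= q%:R.

Proof.
(* This makes [K (1 - eps) - 1] at least 1. *)
have [K K1 hK] : exists2 K, (1 < K)%N & 2 <= K%:R * (1 - eps1).
  exists (Num.truncn (2 / (1 - eps1))).+2 => //.
  rewrite -ler_pdivrMr; last lra.
  by apply/ltW/(lt_trans (truncnS_gt _)); rewrite ltr_nat.
have K2 : (2 : R) <= K%:R by rewrite ler_nat.
have K0 : 0 < K%:R :> R by lra.
(* The condition [hexcl] amounts to [K ^ 2 < la (K (1 - eps) - 1)], so any [la > K ^ 2] will do. *)
pose la : R := K%:R ^+ 2 + 1.
have la0 : 0 < la by rewrite ltr_wpDl ?sqr_ge0.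
(* With this [c], the bound on [th ^ 2 * q * 4 K] is exactly [1/10 * n / (4 K) * tau * n / 8], where
   [n / (4 K)] and [n / 8] bound [G] and [G K - 1] from below. *)
pose c : R := (2560 * la ^+ 2 * K%:R ^+ 2)^-1.
have c0 : 0 < c.
  by rewrite invr_gt0; apply: mulr_gt0; [apply: mulr_gt0|]; rewrite ?ltr0n ?exprn_gt0.
have [N1 hN1] : exists N1, expR (72 * K%:R ^+ 3) <= N1%:R :> R.
  by exists (Num.truncn (expR (72 * K%:R ^+ 3) : R)).+1; exact/ltW/truncnS_gt.
exists c, (N1 + 4 * K + 8)%N; split => //.
move=> n eps d T A q hN eps0 heps A_learns A_most; rewrite leNgt; apply/negP => hq.
(* Here [expR tau] is the square root of [n], at least [36 K ^ 3] by the choice of [N1]; hence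
   [9 K ^ 2 * expR tau <= n / (4 K) <= G]. *)
pose G := (n %/ (2 * K))%N; pose th := la * eps; pose tau : R := ln n%:R / 2.
have n8 : (8 : R) <= n%:R by rewrite ler_nat (leq_trans _ hN)// leq_addl.
have n0 : 0 < n%:R :> R by lra.
have lnn : 72 * K%:R ^+ 3 <= ln n%:R :> R.
  have hexp : expR (72 * K%:R ^+ 3) <= n%:R :> R.
    by apply: (le_trans hN1); rewrite ler_nat (leq_trans _ hN)// -addnA leq_addr.
  by move: hexp; rewrite -ler_ln ?posrE ?expR_gt0// expRK.
have K3 : 1 <= K%:R ^+ 3 :> R by rewrite exprn_ege1//; lra.
have tau0 : 0 < tau by rewrite /tau; lra.
have GKn : (2 * (G * K) <= n)%N.
  by rewrite mulnA [(2 * G)%N]mulnC -mulnA leq_trunc_div.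
have K20 : (0 < 2 * K)%N by rewrite muln_gt0 (ltnW K1).
have G1 : (1 < G)%N.
  rewrite /G leq_divRL// mulnA; apply: leq_trans hN.
  by rewrite -addnA addnCA leq_addr.
have nG : (n <= 4 * K * G)%N.
  apply: (@leq_trans (G.+1 * (2 * K))); first exact/ltnW/ltn_ceil.
  clear -G1; nia.
have nG' : n%:R <= 4 * K%:R * G%:R :> R by rewrite -!natrM ler_nat.
have th0 : 0 <= th by rewrite mulr_ge0 ?ltW.
(* The error [n (1 + th) / B] of one query becomes [1 / (2 q + 1)], so [q] queries lose at most one
   half. *)
pose B := (2 * q%:R + 1) * (n%:R * (1 + th)).
have nth0 : 0 < n%:R * (1 + th) by rewrite mulr_gt0//; lra.
have q0 : 0 <= q%:R :> R by exact: ler0n.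
have B0 : 0 < B by rewrite mulr_gt0//; lra.
have card_le : (#|{: bool * ('I_G * 'I_K)}| <= n)%N.
  by rewrite !card_prod card_bool !card_ord.
(* Items outside the image of [e] belong to no couple and join the tier [None]. *)
pose e v := widen_ord card_le (enum_rank v).
have e_inj : injective e.
  by move=> u v /(congr1 val) /= /val_inj /enum_rank_inj.
have hexcl : eps < (1 + th) / (K%:R + th) - K%:R^-1.
  have -> : (1 + th) / (K%:R + th) - K%:R^-1 =
      th * (K%:R - 1) / (K%:R * (K%:R + th)).
    by field; rewrite !gt_eqF//; lra.
  rewrite ltr_pdivlMr; last by rewrite mulr_gt0//; lra.
  have -> : th * (K%:R - 1) = eps * (la * (K%:R - 1)) by rewrite /th; ring.
  rewrite ltr_pM2l//.
  have : K%:R * (1 - eps1) <= K%:R * (1 - eps) by rewrite ler_pM2l//; lra.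
  rewrite /th => hKe.
  have : la * 1 <= la * (K%:R * (1 - eps) - 1) by rewrite ler_pM2l//; lra.
  rewrite /la; lra.
pose Om : finType := ({ffun 'I_G * 'I_K -> bool} * {perm 'I_G * 'I_K}
       * {ffun option 'I_G -> 'I_K})%type.
pose Mo (o : Om) : mnl R n := tiered_mnl (place e o.1.1 o.1.2) o.2 B0 th0.
have Om0 : (0 < #|Om|)%N.
  apply/card_gt0P; by exists ([ffun=> true], 1%g, [ffun=> Ordinal (ltnW K1)]).
(* Success 9/10 on each instance yields a single seed, with at most [q] queries, whose average
   success over all instances exceeds 6/10. *)
have [||w wq] := exists_seed (Q := fun w => (size (queries A w) <= q)%N)
    (c' := 6 / 10) Om0
    (fun o w => success_given_queries_ge0 eps (Mo o) (queries A w) (output A w))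
    (fun o => A_learns (Mo o)) A_most.
- lra.
- lra.
apply/negP; rewrite -leNgt -[leLHS]/(\sum_(o : Om) _).
have -> : \sum_(o : Om) success_given_queries eps (Mo o) (queries A w) (output A w) =
    \sum_b \sum_t \sum_x success_given_queries eps
      (tiered_mnl (place e b t) x B0 th0) (queries A w) (output A w).
  by rewrite pair_bigA pair_bigA.
have sq : (size (queries A w))%:R <= q%:R :> R by rewrite ler_nat.
apply: (average_success_le (tau := tau)) => //.
- by rewrite /B ler_pMl//; lra.
- have -> : n%:R * (1 + th) / B = (2 * q%:R + 1)^-1.
    by rewrite /B invfM mulrCA divff ?mulr1// gt_eqF.
  rewrite ler_pdivrMr; lra.
- have e36 : 36 * K%:R ^+ 3 <= expR tau.
    by apply: le_trans (expR_ge1Dx _); rewrite /tau; lra.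
  have en : expR tau * expR tau = n%:R.
    by rewrite -expRD /tau -splitr lnK ?posrE.
  have h : 36 * K%:R ^+ 3 * expR tau <= 4 * K%:R * G%:R.
    by apply: le_trans nG'; rewrite -en ler_pM2r// expR_gt0.
  have K4 : 0 < 4 * K%:R :> R by lra.
  rewrite -(ler_pM2l K4); apply: le_trans h.
  by rewrite le_eqVlt; apply/orP; left; apply/eqP; ring.
- have ln0 : 0 < ln n%:R :> R by lra.
  have K4 : 0 < 4 * K%:R :> R by lra.
  have th2 : 0 <= th ^+ 2 by exact: sqr_ge0.
  pose D : R := n%:R ^+ 2 * ln n%:R / (640 * K%:R).
  apply: (@le_trans _ _ D).
    have -> : D = th ^+ 2 * (c * (n%:R ^+ 2 / eps ^+ 2 * ln n%:R)) * (4 * K%:R).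
      by rewrite /D /c /th; field; rewrite !gt_eqF.
    rewrite ler_pM2r//; apply: (ler_wpM2l th2).
    exact: le_trans sq (ltW hq).
  have Gn : n%:R / (4 * K%:R) <= G%:R :> R by rewrite ler_pdivrMr// mulrC.
  (* [G K >= n / 4 >= n / 8 + 1], as [n >= 8]. *)
  have GKn' : n%:R / 8 <= G%:R * K%:R - 1 :> R by lra.
  have -> : D = 10^-1 * (n%:R / (4 * K%:R) * tau * (n%:R / 8)).
    by rewrite /D /tau; field; rewrite gt_eqF.
  have n80 : 0 <= n%:R / 8 :> R by lra.
  have nK0 : 0 <= n%:R / (4 * K%:R) :> R by apply: divr_ge0; exact: ltW.
  rewrite ler_pM2l ?invr_gt0//; apply: ler_pM => //.
    by apply: mulr_ge0 => //; exact: ltW.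
  by rewrite ler_pM2r.
Qed.
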